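(* If $G$ is one of $\{e\}$, $\mathbb{Z}_n$, $D_n$, $S_4$, $A_4$, $A_5$, then $G\times R_k$ is planar for every $k\leq 3$, and $\{e\}\times R_{k'}$ is planar for every $k'\leq 4$.
   Context: $R_k=\{r_1,\dots,r_k\}$ is the right zero band ($r_ir_j=r_j$) and $G\times R_k$ the direct product semigroup. $\mathbb{Z}_n$ is cyclic of order $n$, $D_n$ dihedral of order $2n$, $\{e\}$ the trivial group. For a semigroup $S$ and $C\subseteq S$, $\mathrm{Cay}(S,C)$ is the directed graph on $S$ with arcs $(s,sc)$; $S$ is planar if some generating set $C$ makes $\mathrm{Cay}(S,C)$ (directions, loops, multiple edges ignored) a planar graph. *)

(* Defs.v *)
From HB Require Import structures.
From mathcomp Require Import all_boot all_order all_algebra all_fingroup.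
From mathcomp Require Import classical_sets set_interval reals topology.
From mathcomp Require Import normedtype.
Import numFieldNormedType.Exports.
Set Implicit Arguments.
Unset Strict Implicit.
Unset Printing Implicit Defensive.

Local Open Scope classical_set_scope.
Local Open Scope ring_scope.
Local Open Scope group_scope.

(* An alias of 'I_k, because ordinals already carry the multiplication of the
   additive group of integers modulo k. *)
Definition right_zero_band (k : nat) : Type := 'I_k.

HB.instance Definition _ k := Finite.copy (right_zero_band k) 'I_k.

Definition rzb_mul k (x y : right_zero_band k) : right_zero_band k := y.

Lemma rzb_mulA k : associative (@rzb_mul k).
Proof. by []. Qed.

HB.instance Definition _ k := hasMul.Build (right_zero_band k) (@rzb_mul k).
HB.instance Definition _ k :=
  Magma_isSemigroup.Build (right_zero_band k) (@rzb_mulA k).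

(* Generation as a semigroup: no inverses and no empty product. *)
Definition semigroup_generates (S : semigroupType) (C : {pred S}) : Prop :=
  forall A : {pred S}, {subset C <= A} -> mulg_closed A -> forall x, x \in A.

Definition cay_arc (S : semigroupType) (C : {pred S}) (s t : S) : Prop :=
  exists2 c, c \in C & t = s * c.

(* Adjacency in the underlying simple graph of Cay(S, C). *)
Definition cay_adj (S : semigroupType) (C : {pred S}) (s t : S) : Prop :=
  s <> t /\ (cay_arc C s t \/ cay_arc C t s).

(* A drawing of the simple graph (V, adj) without crossings. Each edge uv is
   given as a simple arc, parametrised once from u to v and once, reversed,
   from v to u. *)
Record plane_drawing (R : realType) (V : Type) (adj : V -> V -> Prop)
    (pos : V -> R * R) (arc : V -> V -> R -> R * R) : Prop := PlaneDrawing {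
  pos_inj : injective pos;
  arc_continuous : forall u v, adj u v ->
    {within `[0%R, 1%R], continuous (arc u v)};
  arc_inj : forall u v, adj u v -> {in `[0%R, 1%R] &, injective (arc u v)};
  arc_start : forall u v, adj u v -> arc u v 0%R = pos u;
  arc_end : forall u v, adj u v -> arc u v 1%R = pos v;
  arc_rev : forall u v, adj u v ->
    {in `[0%R, 1%R], forall t, arc v u t = arc u v (1 - t)%R};
  arc_avoids_vertices : forall u v w, adj u v ->
    {in `]0%R, 1%R[, forall t, arc u v t <> pos w};
  arcs_disjoint : forall u v u' v', adj u v -> adj u' v' ->
    {in `]0%R, 1%R[ &, forall s t, arc u v s = arc u' v' t ->
      (u = u' /\ v = v') \/ (u = v' /\ v = u')}
}.

Definition planar_graph (R : realType) (V : Type) (adj : V -> V -> Prop) :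
    Prop :=
  exists pos arc, @plane_drawing R V adj pos arc.

Definition planar_semigroup (R : realType) (S : semigroupType) : Prop :=
  exists C : {pred S}, semigroup_generates C /\ planar_graph R (cay_adj C).

(* Main.v *)
Require Import Defs.
From Stdlib Require Import ZArith.
From mathcomp Require Import all_boot all_order all_algebra all_fingroup.
From mathcomp Require Import all_solvable reals.
From mathcomp Require Import topology normedtype ring lra zify ssrZ.
Import Order.TTheory GRing.Theory Num.Theory numFieldNormedType.Exports.
Set Implicit Arguments.
Unset Strict Implicit.
Unset Printing Implicit Defensive.

(* Choose [a] and [b] generating [G] such that Cay(G, {a, b}) has a plane
   drawing in which incoming and outgoing arcs alternate around each vertex.
   With C = {(a, r1), (b, r2), (e, r3)}, read (g, r1) and (g, r2) as the two
   arcs of Cay(G, {a, b}) ending at [g]: they are joined in Cay(G x R_3, C) to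
   the two arcs starting at [g], so these vertices form the medial graph of the
   drawing, and (g, r3) is a further vertex placed in the square around [g].
   Hence Cay(G x R_3, C) is planar; k = 2 drops the third colour, and k = 1 uses
   Cay(G, {a, b}) itself. For Z_n (a generator and its inverse) and D_n (two
   reflections) Cay(G, {a, b}) is a doubled cycle and its medial graph a prism.
   For A_4, S_4 and A_5 the pair is a rotation of order 3, 4, 5 and one of
   order 2, and a straight-line drawing with integer coordinates is checked by
   computation. Finally, {e} x R_4 is the complete graph K_4. *)

(** * Straight-line drawings, and pulling a drawing back along an embedding *)

Section StraightLine.
Local Open Scope ring_scope.
Context {R : realType}.

Definition along (p q : R * R) (t : R) : R * R :=
  ((1 - t) * p.1 + t * q.1, (1 - t) * p.2 + t * q.2).

Lemma along_continuous (p q : R * R) : continuous (along p q).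
Proof.
move=> t; have lin (a b : R) :
    {for t, continuous (fun x : R => (1 - x) * a + x * b)}.
  apply: cvgD; apply: cvgM; try exact: cvg_cst; last exact: cvg_id.
  by apply: cvgB; [exact: cvg_cst | exact: cvg_id].
exact: (cvg_pair (lin _ _) (lin _ _)).
Qed.

Lemma along_rev p q t : along q p t = along p q (1 - t).
Proof. by congr pair; ring. Qed.

Lemma along_inj p q : p <> q -> injective (along p q).
Proof.
case: p q => [p1 p2] [q1 q2] pq s t [e1 e2].
have f1 : (s - t) * (q1 - p1) = 0 by lra.
have f2 : (s - t) * (q2 - p2) = 0 by lra.
move/eqP: f1; rewrite mulf_eq0 !subr_eq0 => /orP[/eqP//|/eqP d1].
move/eqP: f2; rewrite mulf_eq0 !subr_eq0 => /orP[/eqP//|/eqP d2].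
by case: pq; rewrite d1 d2.
Qed.

(** Once vertices have distinct positions, segments are continuous, injective and compatible with
    reversal, so only the conditions on crossings remain. *)
Lemma straight_line_planar (V : Type) (adj : V -> V -> Prop)
    (pos : V -> R * R) :
  injective pos ->
  (forall u v, adj u v -> u <> v) ->
  (forall u v w (t : R), adj u v -> 0 < t < 1 ->
     along (pos u) (pos v) t <> pos w) ->
  (forall u v u' v' (s t : R), adj u v -> adj u' v' -> 0 < s < 1 -> 0 < t < 1 ->
     along (pos u) (pos v) s = along (pos u') (pos v') t ->
     (u = u' /\ v = v') \/ (u = v' /\ v = u')) ->
  planar_graph R adj.
Proof.
move=> pos_inj adj_neq avoid disj.
exists pos, (fun u v => along (pos u) (pos v)).
split=> //.
- by move=> u v _; apply: continuous_subspaceT; apply: along_continuous.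
- by move=> u v uv s t _ _; apply: along_inj => /pos_inj; apply: adj_neq.
- by move=> u v _; rewrite /along subr0 !mul1r !mul0r !addr0; case: (pos u).
- by move=> u v _; rewrite /along subrr !mul1r !mul0r !add0r; case: (pos v).
- by move=> u v _ t _; rewrite along_rev.
- by move=> u v w uv t; rewrite in_itv /= => t01; apply: avoid.
- move=> u v u' v' uv uv' s t; rewrite !in_itv /= => s01 t01.
  exact: disj.
Qed.

End StraightLine.

(** Positions and arcs are composed with [f]. Adjacency is preserved but perhaps not reflected, so
    this covers arbitrary subgraphs. *)
Lemma planar_graph_emb (R : realType) (V W : Type) (adjV : V -> V -> Prop)
    (adjW : W -> W -> Prop) (f : V -> W) :
  injective f -> (forall u v, adjV u v -> adjW (f u) (f v)) ->
  planar_graph R adjW -> planar_graph R adjV.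
Proof.
move=> f_inj f_adj [pos [arc [pinj ac ai as_ ae ar av ad]]].
exists (pos \o f), (fun u v => arc (f u) (f v)); split=> /=.
- exact: inj_comp.
- by move=> u v /f_adj; apply: ac.
- by move=> u v /f_adj; apply: ai.
- by move=> u v /f_adj; apply: as_.
- by move=> u v /f_adj; apply: ae.
- by move=> u v /f_adj; apply: ar.
- by move=> u v w /f_adj; apply: av.
- move=> u v u' v' /f_adj uv /f_adj uv' s t s01 t01 e.
  by case: (ad _ _ _ _ uv uv' s t s01 t01 e) => -[/f_inj-> /f_inj->]; auto.
Qed.

(* A computable crossing test for integer segments *)
Delimit Scope Z_scope with coqZ.

Definition pt := (Z * Z)%type.
Definition seg := (pt * pt)%type.

(** The orientation determinant: twice the signed area of the triangle [e.1], [e.2], [r], zero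
    exactly when these are collinear. *)
Definition turn (e : seg) (r : pt) : Z :=
  Z.sub (Z.mul (Z.sub e.2.1 e.1.1) (Z.sub r.2 e.1.2))
        (Z.mul (Z.sub e.2.2 e.1.2) (Z.sub r.1 e.1.1)).

(* Both ends of [f] lie weakly on one side of the line through [e], and not both
   on it; so the interior of [f] misses that line. *)
Definition beside (e f : seg) : bool :=
  match turn e f.1, turn e f.2 with
  | Zpos _, Zneg _ | Zneg _, Zpos _ | Z0, Z0 => false
  | _, _ => true
  end.

Definition pt_eqb (p q : pt) : bool := Z.eqb p.1 q.1 && Z.eqb p.2 q.2.

(** The first alternative settles a vertex sorted after an edge that starts at the same abscissa.
    The last accepts a repeated segment: when a generator is an involution, its edges are listed
    from both ends. *)
Definition seg_apart (e f : seg) : bool :=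
  [|| Z.leb f.2.1 e.1.1, beside e f, beside f e
    | pt_eqb e.1 f.1 && pt_eqb e.2 f.2].

(* The list is sorted by left endpoints, so once some [f] starts to the right of
   the end of [e], so do all later segments. *)
Fixpoint sweep_head (e : seg) (l : seq seg) : bool :=
  if l is f :: l' then
    if Z.leb e.2.1 f.1.1 then true else seg_apart e f && sweep_head e l'
  else true.

Fixpoint sweep (l : seq seg) : bool :=
  if l is e :: l' then sweep_head e l' && sweep l' else true.

Definition orient_seg (e : seg) : seg :=
  if Z.leb e.1.1 e.2.1 then e else (e.2, e.1).

Definition starts_before (e f : seg) : bool := Z.leb e.1.1 f.1.1.

Fixpoint uniq_pts (l : seq pt) : bool :=
  if l is p :: l' then ~~ has (pt_eqb p) l' && uniq_pts l' else true.

(* A vertex enters the sweep as a degenerate segment. *)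
Definition plane_check (vs : seq pt) (es : seq seg) : bool :=
  let es' := [seq orient_seg e | e <- es] in
  [&& uniq_pts vs, all (fun e : seg => Z.ltb e.1.1 e.2.1) es' &
      sweep (sort starts_before ([seq (p, p) | p <- vs] ++ es'))].

(** * Enumerating a permutation group and listing the edges to be drawn *)

(* A permutation of ['I_n] is coded by the list of its images; as in
   [{perm 'I_n}], the left factor acts first. *)
Definition perm_comp (s t : seq nat) : seq nat := [seq nth O t i | i <- s].

Definition push (t : seq nat) (T : seq (seq nat)) : seq (seq nat) :=
  if t \in T then T else rcons T t.

(** [T] is both the queue and the list of visited elements; step [k] expands its entry of index
    [k]. *)
Definition orbit_step (a b : seq nat) (T : seq (seq nat)) (k : nat) :=
  if (k < size T)%N then
    let t := nth [::] T k in push (perm_comp t b) (push (perm_comp t a) T)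
  else T.

(* The codes of the words in [a] and [b], in breadth-first order, provided [N]
   is the order of the generated group. *)
Definition words (a b : seq nat) (N : nat) : seq (seq nat) :=
  foldl (orbit_step a b) [:: iota 0 (size a)] (iota 0 N).

Definition mul_table (T : seq (seq nat)) (a : seq nat) : seq nat :=
  [seq index (perm_comp t a) T | t <- T].

(* The entry of index [x] in a drawing holds the points of (g, r1), (g, r2) and
   (g, r3), where [g] is the [x]-th word; (g, r3) also represents [g] in
   Cay(G, {a, b}). *)
Definition triple := (pt * pt * pt)%type.
Definition triple0 : triple := ((Z0, Z0), (Z0, Z0), (Z0, Z0)).

Definition point_of (d : triple) (j : nat) : pt := nth d.2 [:: d.1.1; d.1.2] j.

Definition points3 (D : seq triple) : seq pt :=
  [seq point_of (nth triple0 D x) j | x <- iota 0 (size D), j <- iota 0 3].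

(** All arcs leaving the three copies of [g], towards (g a, r1), (g b, r2) and (g, r3), except the
    loop at (g, r3). *)
Definition segs3 (A B : seq nat) (D : seq triple) : seq seg :=
  flatten [seq let d := nth triple0 D x in
    let pa := (nth triple0 D (nth O A x)).1.1 in
    let pb := (nth triple0 D (nth O B x)).1.2 in
    [:: (d.1.1, pa); (d.1.2, pa); (d.2, pa); (d.1.1, pb); (d.1.2, pb);
        (d.2, pb); (d.1.1, d.2); (d.1.2, d.2)] | x <- iota 0 (size D)].

Definition segs1 (A B : seq nat) (D : seq triple) : seq seg :=
  flatten [seq let d := nth triple0 D x in
    [:: (d.2, (nth triple0 D (nth O A x)).2);
        (d.2, (nth triple0 D (nth O B x)).2)] | x <- iota 0 (size D)].

Definition drawing_check (A B : seq nat) (D : seq triple) : bool :=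
  plane_check (points3 D) (segs3 A B D) &&
  plane_check [seq (nth triple0 D x).2 | x <- iota 0 (size D)] (segs1 A B D).

(** When [size D] is the order of the group, the conditions on [T] make the words a full list of its
    elements, so the computation also certifies generation. *)
Definition group_check (a b : seq nat) (D : seq triple) : bool :=
  let N := size D in let T := words a b N in
  [&& size T == N, uniq T & drawing_check (mul_table T a) (mul_table T b) D].

(** For the group of order 2, whose doubled cycle is too short for the prism construction; its
    involution serves as both generators. *)
Definition drawing_S2 : seq triple :=
  [:: ((-6, -3), (2, 1), (0, -1)); ((6, -3), (-2, 1), (1, 6))]%coqZ.

(* The coordinates of this and the next two drawings come from numerical
   optimisation of Tutte embeddings, followed by rounding. *)
Definition drawing_A4 : seq triple :=
  [:: ((-80, 59), (-27, -36), (-42, -18)); ((-11, -98), (44, -6), (37, -27));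
  ((-17, -15), (-44, 4), (-29, -12)); ((91, 39), (-17, 41), (5, 46));
  ((22, -7), (18, -41), (25, -19)); ((-23, -2), (-8, 6), (-14, 2));
  ((-4, 22), (26, 36), (4, 31)); ((13, -18), (-1, -10), (6, -13));
  ((-12, -5), (-2, -14), (-8, -11)); ((1, 13), (-11, 8), (-6, 13));
  ((9, 21), (9, 4), (8, 11)); ((10, -8), (13, 6), (14, -2))]%coqZ.

Definition drawing_S4 : seq triple :=
  [:: ((48, 110), (-47, 51), (-30, 69)); ((-110, 48), (-54, -51), (-75, -17));
  ((-41, 39), (-5, 70), (-21, 53)); ((-48, -110), (45, -53), (21, -73));
  ((-39, -34), (-71, 1), (-52, -28)); ((-3, 48), (15, 30), (9, 41));
  ((110, -48), (55, 42), (67, 37)); ((40, -34), (5, -70), (31, -49));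
  ((-58, 2), (-29, 15), (-46, 7)); ((2, 35), (-17, 16), (-5, 28));
  ((30, 20), (23, 60), (25, 33)); ((40, 25), (70, 5), (52, 24));
  ((1, -55), (-13, -34), (-7, -48)); ((-42, -3), (-13, -22), (-29, -8));
  ((-11, 37), (-54, 17), (-33, 27)); ((-8, 2), (8, 23), (-4, 12));
  ((61, -2), (32, -13), (46, -7)); ((8, -41), (21, -13), (10, -30));
  ((-34, -21), (-19, -60), (-24, -39)); ((-3, -7), (-26, 3), (-12, -6));
  ((2, 7), (25, -4), (13, 5)); ((42, 7), (16, 19), (29, 10));
  ((18, -36), (59, -22), (36, -25)); ((5, -3), (-6, -27), (4, -13))]%coqZ.

Definition drawing_A5 : seq triple :=
  [:: ((-346, -50), (-132, -218), (-187, -185));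
  ((-60, -345), (170, -181), (102, -244));
  ((-99, -163), (-221, -126), (-155, -151));
  ((310, -163), (235, 98), (263, 43));
  ((115, -145), (46, -252), (95, -194));
  ((-170, -112), (-136, -40), (-148, -56));
  ((251, 244), (-21, 254), (36, 261)); ((173, 65), (253, -28), (214, 31));
  ((45, -192), (-33, -144), (7, -158));
  ((-124, -74), (-87, -68), (-105, -71));
  ((-149, 24), (-163, -26), (-164, 12));
  ((-154, 314), (-248, 59), (-238, 115));
  ((-10, 187), (105, 232), (37, 213)); ((182, -9), (129, -72), (150, -44));
  ((47, -141), (36, -100), (35, -121));
  ((-70, -124), (-39, -163), (-60, -147));
  ((-98, -99), (-43, -116), (-67, -107));
  ((-79, -30), (-117, -40), (-96, -39));
  ((-202, 45), (-188, 171), (-191, 101));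
  ((73, 171), (103, 99), (84, 136)); ((140, -18), (110, -2), (126, -11));
  ((93, -112), (154, -83), (118, -106));
  ((55, -116), (110, -71), (82, -96)); ((4, -88), (8, -127), (9, -105));
  ((-14, -108), (-58, -87), (-35, -98));
  ((-103, -20), (-105, 40), (-108, 4));
  ((-148, 142), (-52, 133), (-99, 124)); ((54, 142), (26, 101), (49, 116));
  ((130, 54), (124, 117), (135, 84)); ((147, 17), (89, 91), (120, 40));
  ((88, -18), (116, -55), (98, -32)); ((80, -40), (68, -84), (79, -62));
  ((-22, -78), (-40, -40), (-41, -59)); ((-89, 6), (-51, 24), (-73, 21));
  ((-138, 73), (-128, 0), (-129, 33));
  ((-106, 98), (-100, 58), (-101, 81));
  ((-14, 138), (-72, 149), (-34, 154)); ((32, 138), (-36, 120), (0, 122));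
  ((41, 74), (73, 102), (52, 87)); ((60, 69), (107, 25), (80, 65));
  ((62, -57), (16, -54), (41, -61)); ((-25, -53), (9, -35), (-10, -47));
  ((-63, -21), (-71, -69), (-61, -41)); ((-75, -2), (-34, -26), (-47, -9));
  ((-41, 50), (-86, 47), (-58, 48)); ((-46, 73), (-53, 113), (-55, 86));
  ((-39, 89), (6, 104), (-24, 99)); ((68, 53), (55, 9), (66, 28));
  ((50, -43), (46, -4), (48, -27)); ((-4, -68), (43, -86), (13, -73));
  ((8, -14), (-23, -35), (-4, -23)); ((-10, -9), (-35, 7), (-23, -3));
  ((-20, 84), (4, 56), (-7, 72)); ((50, 34), (9, 42), (34, 33));
  ((70, -29), (91, 17), (74, -2)); ((12, 1), (25, -36), (23, -13));
  ((-9, 8), (-4, 40), (-10, 21)); ((-25, 58), (-34, 19), (-27, 39));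
  ((42, 51), (15, 90), (23, 68)); ((4, 15), (40, 10), (17, 16))]%coqZ.

Lemma S2_check : group_check [:: 1; 0]%N [:: 1; 0]%N drawing_S2.
Proof. by vm_compute. Qed.

(** In this check and the next two, the generators have orders r and 2 and their product has order
    3, for r = 3, 4, 5: rotations of the tetrahedron, octahedron and icosahedron. *)
Lemma A4_check : group_check [:: 1; 2; 0; 3]%N [:: 1; 0; 3; 2]%N drawing_A4.
Proof. by vm_compute. Qed.

Lemma S4_check : group_check [:: 1; 2; 3; 0]%N [:: 0; 1; 3; 2]%N drawing_S4.
Proof. by vm_compute. Qed.

Lemma A5_check : group_check [:: 1; 2; 3; 4; 0]%N [:: 0; 2; 1; 4; 3]%N drawing_A5.
Proof. by vm_compute. Qed.

(** * Soundness of the crossing test over the reals *)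

Section PlaneCheck.
Local Open Scope ring_scope.
Context {R : realType}.

Definition real_of_Z (z : Z) : R := (int_of_Z z)%:~R.

Lemma real_of_ZB x y : real_of_Z (Z.sub x y) = real_of_Z x - real_of_Z y.
Proof. by rewrite /real_of_Z -intrB; congr (_%:~R); lia. Qed.

Lemma real_of_ZM x y : real_of_Z (Z.mul x y) = real_of_Z x * real_of_Z y.
Proof. by rewrite /real_of_Z -intrM; congr (_%:~R); lia. Qed.

Lemma real_of_Z_le x y : (real_of_Z x <= real_of_Z y) = Z.leb x y.
Proof. by rewrite /real_of_Z ler_int; lia. Qed.

Lemma real_of_Z_lt x y : (real_of_Z x < real_of_Z y) = Z.ltb x y.
Proof. by rewrite /real_of_Z ltr_int; lia. Qed.

Lemma real_of_Z_inj : injective real_of_Z.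
Proof.
by move=> x y xy; apply/eqP; rewrite eq_le -![_ <= _ :> Z]real_of_Z_le xy lexx.
Qed.

Definition real_pt (p : pt) : R * R := (real_of_Z p.1, real_of_Z p.2).

Lemma real_pt_inj : injective real_pt.
Proof. by case=> [x y] [x' y'] [/real_of_Z_inj-> /real_of_Z_inj->]. Qed.

Definition on_seg (e : seg) (t : R) : R * R :=
  along (real_pt e.1) (real_pt e.2) t.

(** [turn e] is affine and vanishes on the line through [e], while at an interior point of [f] it is
    a proper convex combination of its end values. Those have no opposite signs and are not both
    zero. *)
Lemma beside_disjoint e f (s t : R) :
  beside e f -> 0 < t < 1 -> on_seg e s <> on_seg f t.
Proof.
move=> ef t01 eq_st.
have : (1 - t) * real_of_Z (turn e f.1) + t * real_of_Z (turn e f.2) = 0 :> R.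
  have E1 : (on_seg e s).1 = (on_seg f t).1 :> R by rewrite eq_st.
  have E2 : (on_seg e s).2 = (on_seg f t).2 :> R by rewrite eq_st.
  rewrite /turn !(real_of_ZB, real_of_ZM).
  transitivity
    ((real_of_Z e.2.1 - real_of_Z e.1.1) * ((on_seg f t).2 - real_of_Z e.1.2)
    - (real_of_Z e.2.2 - real_of_Z e.1.2) * ((on_seg f t).1 - real_of_Z e.1.1)).
    by rewrite /on_seg /along /real_pt /=; ring.
  by rewrite -E1 -E2 /on_seg /along /real_pt /=; ring.
have pos p : 0 < real_of_Z (Zpos p) by rewrite (real_of_Z_lt Z0).
have neg p : real_of_Z (Zneg p) < 0 by rewrite (real_of_Z_lt _ Z0).
have z0 : real_of_Z Z0 = 0 by [].
move: ef; rewrite /beside.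
case: (turn e f.1) (turn e f.2) => [|p|p] [|q|q] //= _; rewrite ?z0.
- by have := pos q; nra.
- by have := neg q; nra.
- by have := pos p; nra.
- by have := pos p; have := pos q; nra.
- by have := neg p; nra.
- by have := neg p; have := neg q; nra.
Qed.

Lemma pt_eqP p q : pt_eqb p q -> p = q.
Proof.
by case: p q => [x y] [x' y'] /andP[/Z.eqb_spec/= -> /Z.eqb_spec/= ->].
Qed.

(** The abscissas are weakly separated by [e.2.1], and strictly so on the interior of whichever
    segment is not vertical. *)
Lemma left_disjoint (e f : seg) (s t : R) :
  Z.leb e.1.1 e.2.1 -> Z.leb f.1.1 f.2.1 ->
  Z.ltb e.1.1 e.2.1 || Z.ltb f.1.1 f.2.1 -> Z.leb e.2.1 f.1.1 ->
  0 < s < 1 -> 0 < t < 1 -> on_seg e s <> on_seg f t.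
Proof.
rewrite -!real_of_Z_le -!real_of_Z_lt => e12 f12 ef e2f1 s01 t01 [E _].
by move: E; case/orP: ef => ef /=; nra.
Qed.

Lemma sweep_pairwise l : sorted starts_before l -> sweep l ->
  pairwise (fun e f : seg => Z.leb e.2.1 f.1.1 || seg_apart e f) l.
Proof.
have tr : transitive starts_before.
  by move=> ? ? ?; rewrite /starts_before; lia.
elim: l => //= e l IH el /andP[h_e h_l].
rewrite IH ?(path_sorted el) // andbT.
move: (order_path_min tr el) (path_sorted el) h_e => {IH h_l}.
elim: l {el} => //= f l IH /andP[ef efl] fl.
case: ifP => [e2f1 _ | _ /andP[->]]; last first.
  by rewrite orbT /=; apply: IH => //; exact: path_sorted fl.
apply/allP => g gl.
have := allP (order_path_min tr fl) g gl; rewrite /starts_before.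
by move: e2f1; lia.
Qed.

Lemma uniq_ptsP l : uniq_pts l -> uniq l.
Proof.
elim: l => //= p l IH /andP[pl /IH ->]; rewrite andbT.
apply: contra pl => pl; apply/hasP; exists p => //.
by rewrite /pt_eqb !Z.eqb_refl.
Qed.

Lemma plane_checkP vs es : plane_check vs es ->
  [/\ uniq vs,
   forall e, e \in es -> e.1 <> e.2,
   forall e v (t : R), e \in es -> v \in vs -> 0 < t < 1 ->
     on_seg e t <> real_pt v &
   forall e f (s t : R), e \in es -> f \in es -> 0 < s < 1 -> 0 < t < 1 ->
     on_seg e s = on_seg f t -> e = f \/ e = (f.2, f.1)].
Proof.
rewrite /plane_check; set es' := map _ es; set l := sort _ _.
case/and3P => vs_uniq /allP es_lt sw.
have l_sorted : sorted starts_before l.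
  by apply: sort_sorted => e f; rewrite /starts_before; lia.
have /(pairwiseP ((Z0, Z0), (Z0, Z0))) pw := sweep_pairwise l_sorted sw.
have l_le (e : seg) : e \in l -> Z.leb e.1.1 e.2.1.
  rewrite mem_sort mem_cat => /orP[/mapP[v _ ->]|/es_lt].
    exact: Z.leb_refl.
  by move=> /Z.ltb_lt/Z.lt_le_incl/Z.leb_le.
have apart (e f : seg) (s t : R) : e \in l -> f \in l -> e <> f ->
    Z.ltb e.1.1 e.2.1 || Z.ltb f.1.1 f.2.1 -> 0 < s < 1 -> 0 < t < 1 ->
    on_seg e s <> on_seg f t.
  (* The sweep compares each pair in list order only, but disjointness is symmetric. *)
  wlog: e f s t / (index e l < index f l)%N => [wl el fl ef lt_ef s01 t01|].
    have [ief|] := ltnP (index e l) (index f l); first exact: wl.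
    rewrite leq_eqVlt => /orP[/eqP ief|ife].
      by case: ef; rewrite -(nth_index e el) -ief nth_index.
    by apply/nesym/wl => //; [exact/nesym | rewrite orbC].
  move=> ief el fl ef lt_ef s01 t01.
  have := pw _ _ (etrans (index_mem e l) el) (etrans (index_mem f l) fl) ief.
  rewrite !nth_index // /seg_apart => /or4P[|||/orP[|]].
  - by move=> ?; apply: left_disjoint => //; exact: l_le.
  - by move=> ?; apply/nesym/left_disjoint => //; [exact: l_le..|rewrite orbC].
  - by move=> /beside_disjoint; apply.
  - by move=> /beside_disjoint ?; apply/nesym; auto.
  - case: (e) (f) ef => [? ?] [? ?] ef /andP[/pt_eqP/= ? /pt_eqP/= ?].
    by case: ef; congr pair.
have orient_in (e : seg) : e \in es -> orient_seg e \in l.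
  by move=> ees; rewrite mem_sort mem_cat map_f ?orbT.
have orient_lt (e : seg) :
    e \in es -> Z.ltb (orient_seg e).1.1 (orient_seg e).2.1.
  by move=> ees; apply: es_lt; rewrite map_f.
have orientP (e : seg) (t : R) : exists2 t' : R, (0 < t < 1 -> 0 < t' < 1) &
    on_seg (orient_seg e) t' = on_seg e t.
  rewrite /orient_seg; case: ifP => _; first by exists t.
  by exists (1 - t); [lra | rewrite /on_seg /= -along_rev].
split.
- exact: uniq_ptsP.
- move=> e /orient_lt; rewrite /orient_seg => + e12.
  by case: ifP => _ /=; rewrite e12 Z.ltb_irrefl.
- move=> e v t ees vvs t01.
  have [t' /(_ t01) t'01 <-] := orientP e t.
  (* A vertex is a constant segment, so [apart] applies to it at any parameter. *)
  have -> : real_pt v = on_seg (v, v) t by congr pair => /=; ring.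
  apply: apart => //; first exact: orient_in.
  - by rewrite mem_sort mem_cat map_f.
  - by move=> ev; have := orient_lt _ ees; rewrite ev Z.ltb_irrefl.
  - by rewrite orient_lt.
- move=> e f s t ees fes s01 t01.
  have [s' /(_ s01) s'01 <-] := orientP e s.
  have [t' /(_ t01) t'01 <-] := orientP f t.
  have [ef _|/eqP ef] := eqVneq (orient_seg e) (orient_seg f); last first.
    by move=> st; exfalso; apply: apart st; rewrite ?orient_in ?orient_lt.
  move: ef; rewrite /orient_seg; case: e f {ees fes} => [? ?] [? ?] /=.
  by case: ifP; case: ifP => _ _ [-> ->]; auto.
Qed.

Lemma plane_check_planar (V : Type) (adj : V -> V -> Prop) (pos : V -> pt)
    (vs : seq pt) (es : seq seg) :
  injective pos -> (forall v, pos v \in vs) ->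
  (forall u v, adj u v -> (pos u, pos v) \in es \/ (pos v, pos u) \in es) ->
  plane_check vs es -> planar_graph R adj.
Proof.
move=> pos_inj pos_vs adj_es /plane_checkP[_ es_neq es_vs es_es].
have adjP u v (t : R) : adj u v ->
    exists2 e, e \in es & exists2 t' : R, (0 < t < 1 -> 0 < t' < 1) &
    on_seg e t' = along (real_pt (pos u)) (real_pt (pos v)) t
    /\ (e = (pos u, pos v) \/ e = (pos v, pos u)).
  case/adj_es => ?; [exists (pos u, pos v) | exists (pos v, pos u)] => //.
    by exists t; auto.
  by exists (1 - t); [lra | rewrite /on_seg /= -along_rev; auto].
apply: (@straight_line_planar _ _ _ (real_pt \o pos)) => /=.
- exact: inj_comp real_pt_inj pos_inj.
- by move=> u v /adj_es uv uv_eq; move: uv; rewrite uv_eq => -[] /es_neq.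
- move=> u v w t /(adjP _ _ t)[e ees [t' t01 [<- _]]] /t01 t'01.
  exact: es_vs.
- move=> u v u' v' s t /(adjP _ _ s)[e ees [s' s01 [<- euv]]].
  move=> /(adjP _ _ t)[f fes [t' t01 [<- fuv]]] /s01 s'01 /t01 t'01 /es_es.
  case/(_ ees fes s'01 t'01);
    case: euv fuv => -> [] -> [] /pos_inj-> /pos_inj->; auto.
Qed.

End PlaneCheck.

(** * Generating sets of right groups and their Cayley graphs *)

Local Open Scope group_scope.

(** In a finite group inverses are positive powers, so right multiplication by generators reaches
    all of [<<A>>]. *)
Lemma gen_ind (gT : finGroupType) (A : {set gT}) (P : gT -> Prop) :
  P 1 -> (forall x y, x \in A -> P y -> P (y * x)) ->
  forall x, x \in <<A>> -> P x.
Proof.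
move=> P1 PM x /gen_prodgP[n [c cA ->]].
elim: n c cA => [|n IH] c cA; first by rewrite big_ord0.
by rewrite big_ord_recr /=; apply: PM => //; apply: IH.
Qed.

Section RightGroups.
Context {gT : finGroupType}.
Implicit Types (a b g : gT) (k : nat).

(** At index 2 the list is exhausted, and the default 1 of [nth] supplies the generator (e, r3). *)
Definition colored_gens a b k : {pred gT * right_zero_band k} :=
  fun x => x.1 == nth 1 [:: a; b] x.2.

Definition two_gens a b k : {pred gT * right_zero_band k} :=
  fun x => x.1 \in [:: a; b].

Arguments colored_gens : clear implicits.
Arguments two_gens : clear implicits.

(** A product takes the colour of its right factor. Hence it suffices to reach each group element in
    some colour: (g, j) is then (g c^-1, i) times (c, j). *)
Lemma right_group_generates k (C : {pred gT * right_zero_band k}) :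
    <<[set x.1 | x in C]>> = [set: gT] ->
    (forall j, exists c, (c, j) \in C) ->
  semigroup_generates C.
Proof.
move=> genC surjC A CA Amul [g j].
have inA x (y : gT * right_zero_band k) :
    x \in A -> y \in C -> (x.1 * y.1, y.2) \in A.
  by move=> xA /CA yA; have := Amul _ _ xA yA; case: x y {xA yA} => [? ?] [? ?].
have PA h : (exists i : right_zero_band k, (h, i) \in A).
  have [c cC] := surjC j.
  have step x h' : x \in [set x.1 | x in C] ->
      (exists i : right_zero_band k, (h', i) \in A) ->
      exists i : right_zero_band k, (h' * x, i) \in A.
    by case/imsetP=> y yC -> [i /inA/(_ yC) /= Ay]; exists y.2.
  have : h \in <<[set x.1 | x in C]>> by rewrite genC inE.
  apply: (gen_ind (P := fun h => exists i : right_zero_band k, (h, i) \in A));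
    last exact: step.
  (* There is no empty product, so the identity is reached as the power of [c] to its order, which
     is positive. *)
  have expA n : exists i : right_zero_band k, (c ^+ n.+1, i) \in A.
    elim: n => [|n [i /inA/(_ cC) inA_n]]; first by exists j; rewrite expg1 CA.
    by exists j; rewrite expgSr.
  by rewrite -(expg_order c) -(prednK (order_gt0 c)).
have [c cC] := surjC j.
by have [i /inA/(_ cC)] := PA (g * c^-1); rewrite /= mulgKV.
Qed.

Lemma colored_arc a b k (s t : gT * right_zero_band k) :
  cay_arc (colored_gens a b k) s t <-> t.1 = s.1 * nth 1 [:: a; b] t.2.
Proof.
split=> [[c /eqP cC ->]|]; first by rewrite /= cC.
case: t => [g j] /= ->; exists (nth 1 [:: a; b] j, j); first exact/eqP.
by case: s.
Qed.

Lemma two_arc a b k (s t : gT * right_zero_band k) :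
  cay_arc (two_gens a b k) s t -> t.1 = s.1 * a \/ t.1 = s.1 * b.
Proof.
by move=> [c cC ->]; move: cC; rewrite unfold_in !inE => /orP[]/eqP /= ->; auto.
Qed.

(** The graphs for k = 2, 3 embed in the one for three colours. For k = 1 the single colour has to
    carry both generators. *)
Lemma planar_right_groups (R : realType) a b k :
    <<[set a; b]>> = [set: gT] ->
    planar_graph R (cay_adj (two_gens a b 1)) ->
    planar_graph R (cay_adj (colored_gens a b 3)) ->
  0 < k <= 3 -> planar_semigroup R (gT * right_zero_band k)%type.
Proof.
move=> gen_ab planar1 planar3 /andP[k_gt0 k_le3].
have [k1|k_neq1] := eqVneq k 1%N.
  subst k; exists (two_gens a b 1); split=> //; apply: right_group_generates.
    apply/eqP; rewrite -subTset -gen_ab genS //; apply/subsetP => g.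
    rewrite !inE => gab; apply/imsetP; exists (g, ord0) => //.
    by rewrite unfold_in !inE.
  by move=> j; exists a; rewrite unfold_in mem_head.
have k_gt1 : 1 < k by rewrite ltn_neqAle eq_sym k_neq1.
exists (colored_gens a b k); split.
  apply: right_group_generates.
    apply/eqP; rewrite -subTset -gen_ab genS //; apply/subsetP => g.
    rewrite !inE => /orP[]/eqP->; apply/imsetP.
      by exists (a, Ordinal k_gt0) => //; apply/eqP.
    by exists (b, Ordinal k_gt1) => //; apply/eqP.
  by move=> j; exists (nth 1 [:: a; b] j); apply/eqP.
pose f (x : gT * right_zero_band k) : gT * right_zero_band 3 :=
  (x.1, widen_ord k_le3 x.2).
apply: (planar_graph_emb (f := f)) planar3.
  move=> [g i] [g' i'] [-> ii']; congr pair.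
  exact: val_inj.
move=> u v [uv arcs]; split.
  case: u v uv {arcs} => [g i] [g' i'] uv [gg' ii']; case: uv; congr pair => //.
  exact: val_inj.
by case: arcs => /colored_arc arc; [left|right]; apply/colored_arc.
Qed.

End RightGroups.

Arguments colored_gens {gT} a b k _.
Arguments two_gens {gT} a b k _.

(** * From a checked drawing to planarity *)

Lemma uniq_map_inj (T1 T2 : eqType) (f : T1 -> T2) (s : seq T1) :
  uniq (map f s) -> {in s &, injective f}.
Proof.
move=> fs_uniq x y xs ys fxy; rewrite -(nth_index x xs) -(nth_index x ys).
congr nth; apply/eqP.
rewrite -(nth_uniq (f x) _ _ fs_uniq) ?size_map ?index_mem //.
by rewrite !(nth_map x) ?index_mem // !nth_index // fxy.
Qed.

Section FinitePlanar.
Context {R : realType} {gT : finGroupType}.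

Lemma drawing_planar (a b : gT) (idx : gT -> nat) (A B : seq nat)
    (D : seq triple) :
    injective idx -> (forall g, idx g < size D) ->
    (forall g, idx (g * a) = nth O A (idx g)) ->
    (forall g, idx (g * b) = nth O B (idx g)) ->
    drawing_check A B D ->
  planar_graph R (cay_adj (two_gens a b 1)) /\
  planar_graph R (cay_adj (colored_gens a b 3)).
Proof.
move=> idx_inj idx_lt idxA idxB /andP[check3 check1].
have idx_iota g : idx g \in iota 0 (size D) by rewrite mem_iota add0n idx_lt.
split.
  have [pts_uniq _ _ _] := plane_checkP (R := R) check1.
  pose pos (v : gT * right_zero_band 1) := (nth triple0 D (idx v.1)).2.
  apply: (plane_check_planar (pos := pos) _ _ _ check1).
  - move=> [g i] [h j] gh; congr pair; last by rewrite (ord1 i) (ord1 j).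
    exact/idx_inj/(uniq_map_inj pts_uniq).
  - by move=> v; apply/mapP; exists (idx v.1).
  - suff arc_in u v : cay_arc (two_gens a b 1) u v ->
        (pos u, pos v) \in segs1 A B D.
      by move=> u v [_ [/arc_in|/arc_in]]; auto.
    move=> uv; apply/flatten_mapP; exists (idx u.1) => //; rewrite /pos.
    by case: (two_arc uv) => ->; rewrite ?idxA ?idxB !inE eqxx ?orbT.
have [pts_uniq _ _ _] := plane_checkP (R := R) check3.
pose pos (v : gT * right_zero_band 3) := point_of (nth triple0 D (idx v.1)) v.2.
have iota3 (j : right_zero_band 3) : (j : nat) \in iota 0 3.
  by rewrite mem_iota /= ltn_ord.
apply: (plane_check_planar (pos := pos) _ _ _ check3).
- move=> [g i] [h j] eq_pos.
  pose at_ (z : nat * nat) := point_of (nth triple0 D z.1) z.2.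
  have points_at : points3 D =
      map at_ [seq (x, j) | x <- iota 0 (size D), j <- iota 0 3].
    by rewrite map_allpairs.
  move: pts_uniq; rewrite points_at => /uniq_map_inj at_inj.
  suff [/idx_inj-> /val_inj->] : (idx g, i : nat) = (idx h, j : nat) by [].
  by apply: at_inj; rewrite ?allpairs_f.
- by move=> v; apply: allpairs_f.
- suff arc_in u v : u <> v -> cay_arc (colored_gens a b 3) u v ->
      (pos u, pos v) \in segs3 A B D \/ (pos v, pos u) \in segs3 A B D.
    move=> u v [uv [/(arc_in _ _ uv)|/(arc_in _ _ (nesym uv))]] //.
    by case; auto.
  case: u v => [g [i i3]] [h [j j3]] uv /colored_arc/= hE; subst h; left.
  apply/flatten_mapP; exists (idx g) => //; rewrite /pos /=.
  move: j j3 i i3 uv => [|[|[|//]]] j3 [|[|[|//]]] i3 uv /=;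
    rewrite ?mulg1 ?idxA ?idxB !inE ?eqxx ?orbT //.
  (* The only unlisted arc is the loop at (g, r3). *)
  by case: uv; rewrite /= mulg1; congr pair; apply: val_inj.
Qed.

Lemma words_gen (cd : gT -> seq nat) (a b : gT) N :
    (forall g h, cd (g * h) = perm_comp (cd g) (cd h)) ->
    cd 1 = iota 0 (size (cd a)) ->
  {subset words (cd a) (cd b) N <= [seq cd g | g in <<[set a; b]>>]}.
Proof.
move=> cdM cd1; rewrite /words; set img := [seq cd g | g in _].
have : {subset [:: iota 0 (size (cd a))] <= img}.
  by move=> t; rewrite inE => /eqP->; rewrite -cd1 map_f ?mem_enum ?group1.
have push_img t T : t \in img -> {subset T <= img} -> {subset push t T <= img}.
  move=> t_img T_img x; rewrite /push; case: ifP => _; first exact: T_img.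
  by rewrite mem_rcons inE => /predU1P[->|/T_img].
have comp_img c t : c \in [set a; b] -> t \in img -> perm_comp t (cd c) \in img.
  move=> c_ab /mapP[g]; rewrite mem_enum => g_ab ->.
  by rewrite -cdM; apply: map_f; rewrite mem_enum groupM // mem_gen.
elim: (iota 0 N) [:: iota 0 _] => //= k s IH T T_img; apply: IH.
rewrite /orbit_step; case: ltnP => [kT|//].
have kimg := T_img _ (mem_nth [::] kT).
apply: (push_img); first by rewrite comp_img // !inE eqxx orbT.
by apply: push_img => //; rewrite comp_img // !inE eqxx.
Qed.

(** The words are distinct codes of elements of [<<[set a; b]>>], as many as the order of the group.
    Counting shows that [a] and [b] generate and that every element is listed. *)
Lemma coded_planar (cd : gT -> seq nat) (a b : gT) (D : seq triple) :
    injective cd -> (forall g h, cd (g * h) = perm_comp (cd g) (cd h)) ->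
    cd 1 = iota 0 (size (cd a)) -> #|gT| = size D ->
    group_check (cd a) (cd b) D ->
  [/\ <<[set a; b]>> = [set: gT],
   planar_graph R (cay_adj (two_gens a b 1)) &
   planar_graph R (cay_adj (colored_gens a b 3))].
Proof.
move=> cd_inj cdM cd1 card_gT; rewrite /group_check.
set T := words _ _ _ => /and3P[/eqP sizeT uniqT checkD].
have T_sub : {subset T <= _} := words_gen (N := size D) cdM cd1.
have gen_ab : <<[set a; b]>> = [set: gT].
  apply/eqP; rewrite eqEcard subsetT cardsT card_gT -sizeT.
  by rewrite (leq_trans (uniq_leq_size uniqT T_sub)) // size_map cardE.
have cdT g : cd g \in T.
  have le_T : size [seq cd g | g in <<[set a; b]>>] <= size T.
    by rewrite size_map -cardE gen_ab cardsT card_gT sizeT.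
  have [_ ->] := uniq_min_size uniqT T_sub le_T.
  by apply: map_f; rewrite mem_enum gen_ab inE.
have idxM c g :
    index (cd (g * c)) T = nth O (mul_table T (cd c)) (index (cd g) T).
  by rewrite (nth_map [::]) ?index_mem // nth_index // cdM.
have idx_inj : injective (fun g => index (cd g) T).
  by move=> g h /(congr1 (nth [::] T)); rewrite !nth_index //; exact: cd_inj.
have idx_lt g : index (cd g) T < size D by rewrite -sizeT index_mem.
by have [] := drawing_planar idx_inj idx_lt (idxM a) (idxM b) checkD.
Qed.

End FinitePlanar.

(** * Coding permutations by lists of images *)

Section PermCode.
Context {n : nat}.
Implicit Types s t : {perm 'I_n}.

Definition code s : seq nat := [seq val (s i) | i <- enum 'I_n].

Lemma size_code s : size (code s) = n.
Proof. by rewrite size_map size_enum_ord. Qed.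

Lemma nth_code s (i : 'I_n) : nth O (code s) i = s i.
Proof. by rewrite (nth_map i) ?size_enum_ord // nth_ord_enum. Qed.

Lemma code_inj : injective code.
Proof.
by move=> s t st; apply/permP => i; apply: val_inj; rewrite /= -!nth_code st.
Qed.

Lemma codeM s t : code (s * t) = perm_comp (code s) (code t).
Proof.
rewrite /perm_comp {1}/code {2}/code -map_comp; apply: eq_map => i /=.
by rewrite nth_code permM.
Qed.

Lemma code1 : code 1 = iota 0 n.
Proof. by rewrite -val_enum_ord; apply: eq_map => i; rewrite perm1. Qed.

(** Introduces a permutation with a prescribed closed list as code, so that facts about it reduce to
    computation. *)
Lemma code_surj (l : seq nat) : perm_eq l (iota 0 n) -> exists s, code s = l.
Proof.
move=> l_perm; have size_l : size l = n by rewrite (perm_size l_perm) size_iota.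
have l_lt (i : 'I_n) : nth O l i < n.
  have := mem_nth O (etrans (f_equal _ size_l) (ltn_ord i)).
  by rewrite (perm_mem l_perm) mem_iota.
have inj : injective (fun i => Ordinal (l_lt i)).
  move=> i j [] /eqP; rewrite nth_uniq ?size_l // => [/eqP/val_inj //|].
  by rewrite (perm_uniq l_perm) iota_uniq.
exists (perm inj); apply: (@eq_from_nth _ O); first by rewrite size_code.
by rewrite size_code => i i_lt; rewrite (nth_code _ (Ordinal i_lt)) permE.
Qed.

Lemma even_perm_odd_order s k : odd k -> s ^+ k = 1 -> ~~ odd_perm s.
Proof.
move=> k_odd sk; have: odd_perm (s ^+ k) = false by rewrite sk odd_perm1.
have -> : odd_perm (s ^+ k) = odd k && odd_perm s.
  elim: k {k_odd sk} => [|k IH]; first by rewrite odd_perm1.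
  by rewrite expgS odd_permM IH /=; case: odd; case: odd_perm.
by rewrite k_odd /= => ->.
Qed.

End PermCode.

(** * The group of order two and the polyhedral rotation groups *)

Lemma perm_group_planar (R : realType) n (gT : finGroupType)
    (G : {group {perm 'I_n}}) (a b : {perm 'I_n}) (D : seq triple) k :
    [set: gT] \isog G -> a \in G -> b \in G -> #|G| = size D ->
    group_check (code a) (code b) D -> 0 < k <= 3 ->
  planar_semigroup R (gT * right_zero_band k)%type.
Proof.
move=> isoG Ga Gb card_G check k_le.
have card_gT : #|gT| = size D by rewrite -cardsT (card_isog isoG).
case/isogP: isoG => f injf fG.
have [a' _ Ea] : exists2 a', a' \in [set: gT] & a = f a'.
  by move: Ga; rewrite -fG => /morphimP[a' ? ? ->]; exists a'.
have [b' _ Eb] : exists2 b', b' \in [set: gT] & b = f b'.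
  by move: Gb; rewrite -fG => /morphimP[b' ? ? ->]; exists b'.
subst a b.
have cd_inj : injective (code \o f).
  by apply: inj_comp code_inj _ => x y; apply: (injmP injf); rewrite inE.
have cdM x y : (code \o f) (x * y) = perm_comp ((code \o f) x) ((code \o f) y).
  by rewrite /= morphM ?inE // codeM.
have cd1 : (code \o f) 1 = iota 0 (size ((code \o f) a')).
  by rewrite /= morph1 code1 size_code.
have [gen_ab planar1 planar3] :=
  coded_planar (R := R) cd_inj cdM cd1 card_gT check.
exact: planar_right_groups planar1 planar3 k_le.
Qed.

Section PolyhedralGroups.
Context {R : realType} {gT : finGroupType} {k : nat}.
Context (k_le3 : 0 < k <= 3).

Lemma Sym2_planar : [set: gT] \isog 'Sym_('I_2) ->
  planar_semigroup R (gT * right_zero_band k)%type.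
Proof.
have [a Ea] := code_surj (n := 2) (l := [:: 1; 0]%N) isT.
move=> iso.
apply: (@perm_group_planar R _ gT ('Sym_('I_2))%G a a drawing_S2 k iso) => //.
- by rewrite inE.
- by rewrite inE.
- by rewrite card_Sym card_ord.
- by rewrite Ea S2_check.
Qed.

Lemma Sym4_planar : [set: gT] \isog 'Sym_('I_4) ->
  planar_semigroup R (gT * right_zero_band k)%type.
Proof.
have [a Ea] := code_surj (n := 4) (l := [:: 1; 2; 3; 0]%N) isT.
have [b Eb] := code_surj (n := 4) (l := [:: 0; 1; 3; 2]%N) isT.
move=> iso.
apply: (@perm_group_planar R _ gT ('Sym_('I_4))%G a b drawing_S4 k iso) => //.
- by rewrite inE.
- by rewrite inE.
- by rewrite card_Sym card_ord.
- by rewrite Ea Eb S4_check.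
Qed.

Lemma Alt4_planar : [set: gT] \isog 'Alt_('I_4) ->
  planar_semigroup R (gT * right_zero_band k)%type.
Proof.
have [a Ea] := code_surj (n := 4) (l := [:: 1; 2; 0; 3]%N) isT.
have [b Eb] := code_surj (n := 4) (l := [:: 1; 0; 3; 2]%N) isT.
have a_even : ~~ odd_perm a.
  apply: (@even_perm_odd_order _ _ 3) => //; apply: code_inj.
  by rewrite !expgS expg0 mulg1 !codeM Ea code1.
(* [b] has even order, so its sign is read off from those of [a] and [a * b], which have odd
   order. *)
have ab_even : ~~ odd_perm (a * b).
  apply: (@even_perm_odd_order _ _ 3) => //; apply: code_inj.
  by rewrite !expgS expg0 mulg1 !codeM Ea Eb code1.
move=> iso.
apply: (@perm_group_planar R _ gT ('Alt_('I_4))%G a b drawing_A4 k iso) => //.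
- by rewrite Alt_even.
- by move: ab_even; rewrite Alt_even odd_permM (negPf a_even).
- by apply/eqP; rewrite -(eqn_pmul2l (isT : 0 < 2)) card_Alt ?card_ord.
- by rewrite Ea Eb A4_check.
Qed.

Lemma Alt5_planar : [set: gT] \isog 'Alt_('I_5) ->
  planar_semigroup R (gT * right_zero_band k)%type.
Proof.
have [a Ea] := code_surj (n := 5) (l := [:: 1; 2; 3; 4; 0]%N) isT.
have [b Eb] := code_surj (n := 5) (l := [:: 0; 2; 1; 4; 3]%N) isT.
have a_even : ~~ odd_perm a.
  apply: (@even_perm_odd_order _ _ 5) => //; apply: code_inj.
  by rewrite !expgS expg0 mulg1 !codeM Ea code1.
have ab_even : ~~ odd_perm (a * b).
  apply: (@even_perm_odd_order _ _ 3) => //; apply: code_inj.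
  by rewrite !expgS expg0 mulg1 !codeM Ea Eb code1.
move=> iso.
apply: (@perm_group_planar R _ gT ('Alt_('I_5))%G a b drawing_A5 k iso) => //.
- by rewrite Alt_even.
- by move: ab_even; rewrite Alt_even odd_permM (negPf a_even).
- by apply/eqP; rewrite -(eqn_pmul2l (isT : 0 < 2)) card_Alt ?card_ord.
- by rewrite Ea Eb A5_check.
Qed.

End PolyhedralGroups.

(** * The trivial group *)

Lemma trivial_planar (R : realType) (gT : finGroupType) k :
  [set: gT] = 1 -> 0 < k <= 4 ->
  planar_semigroup R (gT * right_zero_band k)%type.
Proof.
move=> gT1 /andP[k_gt0 k_le4].
have eq1 (g : gT) : g = 1.
  by apply/set1P; rewrite -[[set 1]]/(1 : {set gT}) -gT1 inE.
exists (fun=> true); split; first by move=> A CA _ x; exact: CA.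
(* The point (0, 2) lies inside the triangle of the other three. The abscissas are distinct because
   the test rejects vertical edges. *)
pose pts : seq pt := [:: (3, 0); (-3, 1); (0, 2); (-1, 3)]%coqZ.
pose es : seq seg := [seq (nth (Z0, Z0) pts z.1, nth (Z0, Z0) pts z.2) |
  z <- [:: (0, 1); (0, 2); (0, 3); (1, 2); (1, 3); (2, 3)]%N].
have check : plane_check pts es by vm_compute.
have pts_uniq : uniq pts by [].
pose pos (v : gT * right_zero_band k) := nth (Z0, Z0) pts v.2.
have lt4 (i : right_zero_band k) : i < size pts by apply: leq_trans k_le4.
apply: (plane_check_planar (pos := pos) _ _ _ check).
- move=> [g i] [h j] /eqP; rewrite nth_uniq // => /eqP/val_inj/= ->.
  by rewrite (eq1 g) (eq1 h).
- by move=> v; apply: mem_nth.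
- move=> [g i] [h j] [uv _]; have {uv} : i != j :> nat.
    by apply/eqP => /val_inj ij; apply: uv; rewrite (eq1 g) (eq1 h) ij.
  rewrite /pos /=; move: (lt4 i) (lt4 j).
  by case: (i : nat) (j : nat) => [|[|[|[|?]]]] [|[|[|[|?]]]] //= _ _ _; auto.
Qed.

(** * A prism with coned lateral squares, and its drawing *)

Inductive layer := Inner | Outer | Centre.

(** Centre [i] lies in the square between rungs [i] and [ordS i] and is joined to its four
    corners. *)
Inductive edge_kind := InnerRim | OuterRim | Rung
  | CentreInner | CentreOuter | CentreNextInner | CentreNextOuter.

Section Prism.
Local Open Scope ring_scope.
Context {R : realType} {m : nat}.
Context (m_gt2 : (2 < m)%N).
Implicit Types (i j : 'I_m) (e f : edge_kind).

Definition edge_src e i : 'I_m * layer :=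
  match e with
  | InnerRim | Rung => (i, Inner)
  | OuterRim => (i, Outer)
  | _ => (i, Centre)
  end.

Definition edge_tgt e i : 'I_m * layer :=
  match e with
  | InnerRim | CentreNextInner => (ordS i, Inner)
  | OuterRim | CentreNextOuter => (ordS i, Outer)
  | CentreInner => (i, Inner)
  | Rung | CentreOuter => (i, Outer)
  end.

Definition prism_adj (u v : 'I_m * layer) : Prop :=
  exists e i, (u = edge_src e i /\ v = edge_tgt e i) \/
              (v = edge_src e i /\ u = edge_tgt e i).

(* The inner rim is the polygon with corners (0, -1) and (x, 1) for [m - 1]
   evenly spaced abscissas x from -1 to 1; the outer rim is its homothetic image
   of ratio 3. Each edge lies in the sector spanned by two consecutive corners,
   where the crossing conditions become linear. *)
Definition abscissa (n : nat) : R := (2 * (n%:R - 1)) / (m%:R - 2) - 1.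

Definition corner (n : nat) : R * R :=
  if n is 0 then (0, -1) else (abscissa n, 1).

Definition in_sector i (a b : R) : R * R :=
  (a * (corner i).1 + b * (corner (ordS i)).1,
   a * (corner i).2 + b * (corner (ordS i)).2).

Let m2_gt0 : 0 < m%:R - 2 :> R.
Proof. by rewrite subr_gt0 ltr_nat. Qed.

Lemma abscissa_lt n n' : (n < n')%N -> abscissa n < abscissa n'.
Proof.
move=> nn'; rewrite /abscissa ltrD2r ltr_pM2r ?invr_gt0 //.
by rewrite ltr_pM2l // ltrD2r ltr_nat.
Qed.

Lemma abscissa_le n n' : (n <= n')%N -> abscissa n <= abscissa n'.
Proof. by rewrite leq_eqVlt => /orP[/eqP->|/abscissa_lt/ltW]. Qed.

Lemma abscissa1 : abscissa 1 = -1.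
Proof. by rewrite /abscissa subrr mulr0 mul0r add0r. Qed.

Lemma abscissa_last : abscissa m.-1 = 1.
Proof.
rewrite /abscissa; have -> : m.-1%:R = m%:R - 1 :> R.
  by rewrite -subn1 natrB // (ltn_trans _ m_gt2).
by field; rewrite gt_eqF.
Qed.

(** The first and last sectors meet at the bottom corner (0, -1); the others lie below the top side,
    where the ordinate is [a + b]. *)
Variant sector_spec i (a b : R) : R * R -> Type :=
| FirstSector of i = 0%N :> nat : sector_spec i a b (- b, b - a)
| LastSector of i = m.-1 :> nat : sector_spec i a b (a, a - b)
| MiddleSector of (0 < i)%N & (i < m.-1)%N :
    sector_spec i a b (a * abscissa i + b * abscissa i.+1, a + b).

Lemma sectorP i a b : sector_spec i a b (in_sector i a b).
Proof.
have i_lt := ltn_ord i; rewrite /in_sector /=.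
have [i0|i_gt0] := posnP i.
  rewrite i0 modn_small ?(ltn_trans _ m_gt2) //= abscissa1.
  have -> : (a * 0 + b * -1, a * -1 + b * 1) = (- b, b - a) by congr pair; ring.
  exact: FirstSector.
have corner_i : corner i = (abscissa i, 1) by case: (i : nat) i_gt0.
rewrite corner_i /=.
have [i_last|i_lt'] := eqVneq (i : nat) m.-1.
  rewrite i_last prednK ?(ltn_trans _ m_gt2) // modnn /= abscissa_last.
  have -> : (a * 1 + b * 0, a * 1 + b * -1) = (a, a - b) by congr pair; ring.
  exact: LastSector.
have {}i_lt' : (i < m.-1)%N by lia.
rewrite modn_small /= ?mulr1; last by lia.
exact: MiddleSector.
Qed.

(** With [0 < a] and [0 <= b] a sector contains its first bounding ray but not its second, which
    belongs to the next sector; so the sectors are disjoint. *)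
Lemma in_sector_inj i j a b a' b' :
    0 < a -> 0 <= b -> 0 < a' -> 0 <= b' ->
    in_sector i a b = in_sector j a' b' -> [/\ i = j, a = a' & b = b'].
Proof.
wlog: i j a b a' b' / (i <= j)%N => [wl|].
  have [ij|/ltnW ji] := leqP i j; first exact: wl.
  by move=> ? ? ? ? /esym /wl[] // -> -> ->.
move=> ij a_gt0 b_ge0 a'_gt0 b'_ge0.
have eq_nat : i = j :> nat -> i = j by apply: val_inj.
have range n : (0 < n)%N -> (n <= m.-1)%N -> -1 <= abscissa n <= 1.
  move=> n_gt0 n_le; apply/andP; split.
    by rewrite -abscissa1 abscissa_le.
  by rewrite -abscissa_last abscissa_le.
case: sectorP => [i0|i1|i_gt0 i_lt]; case: sectorP => [j0|j1|j_gt0 j_lt] [].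
- by move=> E1 E2; split; [apply: eq_nat; lia | lra | lra].
- by move=> E1 E2; lra.
- move=> E1 E2.
  have /andP[xj _] := range j j_gt0 (ltnW j_lt).
  have /andP[xj' _] := range j.+1 isT j_lt.
  by nra.
- by move=> E1 E2; lia.
- by move=> E1 E2; split; [apply: eq_nat; lia | lra | lra].
- by lia.
- by lia.
- move=> E1 E2.
  have : abscissa i < 1 by rewrite -abscissa_last abscissa_lt.
  have /andP[_ xi'] := range i.+1 isT i_lt.
  by nra.
(* Equal ordinates give equal sums of weights, so the weighted means of abscissas lie in half-open
   intervals, disjoint for i < j. *)
- move=> E1 E2.
  have xi := abscissa_lt (ltnSn i); have xj := abscissa_lt (ltnSn j).
  have [lt_ij|le_ji] := ltnP i j.
    have xij := abscissa_le lt_ij.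
    by nra.
  have eq_ij : i = j by apply: eq_nat; lia.
  move: E1; rewrite eq_ij => E1; move: xi; rewrite eq_ij => xi.
  have E : (a - a') * (abscissa j.+1 - abscissa j) = 0.
    have bE : b = a' + b' - a by lra.
    by move: E1; rewrite bE => E1; lra.
  move/eqP: E; rewrite mulf_eq0 !subr_eq0 (gt_eqF xi) orbF => /eqP aa'.
  by split=> //; lra.
Qed.

(** In each sector the rims are the lines a + b = 1 and a + b = 3; the centre lies on a + b = 2. *)
Definition layer_coord (x : layer) : R * R :=
  match x with Inner => (1, 0) | Outer => (3, 0) | Centre => (1, 1) end.

Definition prism_pos (v : 'I_m * layer) : R * R :=
  in_sector v.1 (layer_coord v.2).1 (layer_coord v.2).2.

Definition edge_coord e (t : R) : R * R :=
  match e with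
  | InnerRim => (1 - t, t)
  | OuterRim => (3 * (1 - t), 3 * t)
  | Rung => (1 + 2 * t, 0)
  | CentreInner => (1, 1 - t)
  | CentreOuter => (1 + 2 * t, 1 - t)
  | CentreNextInner => (1 - t, 1)
  | CentreNextOuter => (1 - t, 1 + 2 * t)
  end.

(** The corner [ordS i] has coordinates (0, 1) in sector [i], so both ends of an edge lie in that
    closed sector and interpolation is linear there. *)
Lemma along_edge e i t :
  along (prism_pos (edge_src e i)) (prism_pos (edge_tgt e i)) t =
  in_sector i (edge_coord e t).1 (edge_coord e t).2.
Proof.
by case: e; rewrite /along /prism_pos /in_sector /=; congr pair; ring.
Qed.

Lemma layer_coord_gt0 x : 0 < (layer_coord x).1 /\ 0 <= (layer_coord x).2.
Proof. by case: x => /=; lra. Qed.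

Lemma edge_coord_gt0 e (t : R) :
  0 < t < 1 -> 0 < (edge_coord e t).1 /\ 0 <= (edge_coord e t).2.
Proof. by move=> t01; case: e => /=; lra. Qed.

Lemma prism_pos_inj : injective prism_pos.
Proof.
move=> [i x] [j y]; have [x1 x2] := layer_coord_gt0 x.
have [y1 y2] := layer_coord_gt0 y.
move=> /(in_sector_inj x1 x2 y1 y2)[] /= -> {x1 x2 y1 y2}.
by case: x; case: y => //= E1 E2; exfalso; lra.
Qed.

(** Edges can only meet within one sector, where the seven paths of [edge_coord] are compared by
    linear arithmetic. *)
Lemma prism_planar : planar_graph R prism_adj.
Proof.
have adjP u v (t : R) : prism_adj u v -> exists e i, exists2 t' : R,
    (0 < t < 1 -> 0 < t' < 1) &
    in_sector i (edge_coord e t').1 (edge_coord e t').2 =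
      along (prism_pos u) (prism_pos v) t /\
    ((u = edge_src e i /\ v = edge_tgt e i) \/
     (v = edge_src e i /\ u = edge_tgt e i)).
  move=> [e [i [[uE vE]|[uE vE]]]]; exists e, i.
    by exists t => //; rewrite -along_edge uE vE; auto.
  by exists (1 - t); [lra | rewrite -along_edge uE vE -along_rev; auto].
apply: (@straight_line_planar _ _ _ prism_pos).
- exact: prism_pos_inj.
- have ordS_neq i : i <> ordS i.
    move=> /(congr1 val)/= iE; have := ltn_ord i.
    rewrite leq_eqVlt => /orP[/eqP im|im].
      by move: iE; rewrite im modnn => i0; move: m_gt2; rewrite -im i0.
    by move: iE; rewrite modn_small //; lia.
  move=> u v [e [i [[-> ->]|[-> ->]]]]; case: e => -[] // iE;
    by case: (ordS_neq i).
- move=> u v w t /(adjP _ _ t)[e [i [t' t01 [<- _]]]] /t01 t'01.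
  have [e1 e2] := edge_coord_gt0 e t'01; have [x1 x2] := layer_coord_gt0 w.2.
  move=> /(in_sector_inj e1 e2 x1 x2)[_] {e1 e2 x1 x2}.
  by case: e; case: w.2 => /= E1 E2; lra.
- move=> u v u' v' s t /(adjP _ _ s)[e [i [s' s01 [<- uv]]]].
  move=> /(adjP _ _ t)[f [j [t' t01 [<- uv']]]] /s01 s'01 /t01 t'01.
  have [e1 e2] := edge_coord_gt0 e s'01; have [f1 f2] := edge_coord_gt0 f t'01.
  move=> /(in_sector_inj e1 e2 f1 f2)[ij] {e1 e2 f1 f2}; subst j.
  have same : e = f -> (u = u' /\ v = v') \/ (u = v' /\ v = u').
    by move=> ef; subst f; case: uv uv' => -[-> ->] [] [-> ->]; auto.
  case: e f {uv uv'} same => -[] /= same E1 E2; try exact: same.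
  all: by exfalso; lra.
Qed.

End Prism.

(** * Groups whose Cayley graph is a doubled cycle *)

Section CyclicWalk.
Context {R : realType} {gT : finGroupType} {m : nat}.
Context (a b : gT) (d : gT -> 'I_m).
Context (m_gt2 : 2 < m) (ab : a != b) (d_inj : injective d).
Context (d_step : forall g c, c \in [:: a; b] ->
  d (g * c) = ordS (d g) \/ d g = ordS (d (g * c))).

(* [d] numbers the doubled cycle Cay(G, {a, b}). The vertex (g, r1) or (g, r2)
   is the arc ending at [g] with that label: it goes to the inner rim if it runs
   forwards along the cycle, and to the outer rim if it runs backwards. *)
Definition walk_embedding (v : gT * right_zero_band 3) : 'I_m * layer :=
  if (v.2 < 2)%N then
    let h := v.1 * (nth 1 [:: a; b] v.2)^-1 in
    if d v.1 == ordS (d h) then (d v.1, Inner) else (d h, Outer)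
  else (d v.1, Centre).

Let gen_mem (j : nat) : (j < 2)%N -> nth 1 [:: a; b] j \in [:: a; b].
Proof. by move=> j2; rewrite mem_nth. Qed.

Lemma step_back (g c : gT) : c \in [:: a; b] -> d g != ordS (d (g * c^-1)) ->
  d (g * c^-1) = ordS (d g).
Proof.
move=> c_ab; case: (d_step (g * c^-1) c_ab); rewrite mulgKV // => ->.
by rewrite eqxx.
Qed.

(** The arcs ending at [g] occupy opposite corners of the square with centre [(d g, Centre)]. *)
Lemma walk_source g (i : right_zero_band 3) :
  [\/ walk_embedding (g, i) = (d g, Inner),
      walk_embedding (g, i) = (ordS (d g), Outer) |
      walk_embedding (g, i) = (d g, Centre) /\ i = 2 :> nat].
Proof.
rewrite /walk_embedding /=; case: ifP => [i2|i2]; last first.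
  by apply: Or33; split=> //; have := ltn_ord i; lia.
case: ifPn => [gi|gi]; first exact: Or31.
by apply: Or32; rewrite step_back ?gen_mem.
Qed.

(** The arcs starting at [g] occupy the other two corners of the same square, so incoming and
    outgoing arcs alternate. *)
Lemma walk_target g (j : right_zero_band 3) (h := g * nth 1 [:: a; b] j) :
  [\/ walk_embedding (h, j) = (ordS (d g), Inner),
      walk_embedding (h, j) = (d g, Outer) |
      walk_embedding (h, j) = (d g, Centre) /\ j = 2 :> nat].
Proof.
rewrite /walk_embedding /= {}/h; case: ifP => [j2|j2]; last first.
  have -> : j = 2 :> nat by have := ltn_ord j; lia.
  by rewrite mulg1; apply: Or33.
by rewrite mulgK; case: eqP => [->|_]; [apply: Or31 | apply: Or32].
Qed.

(** The rim gives the direction of an arc and the index then fixes both its ends; since [a] and [b]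
    differ, the ends determine the label. *)
Lemma walk_embedding_inj : injective walk_embedding.
Proof.
have gen_inj i j : (i < 2)%N -> (j < 2)%N ->
    nth 1 [:: a; b] i = nth 1 [:: a; b] j -> i = j.
  by move=> i2 j2 /eqP; rewrite nth_uniq //= ?inE ?ab // => /eqP.
move=> [g i] [h j]; rewrite /walk_embedding /=.
have [i2|i2] := boolP (i < 2)%N; have [j2|j2] := boolP (j < 2)%N.
- pose p (x : gT) (n : nat) := x * (nth 1 [:: a; b] n)^-1.
  have [gi|gi] := eqVneq (d g) (ordS (d (p g i)));
    have [hj|hj] := eqVneq (d h) (ordS (d (p h j))) => // -[].
    move=> /d_inj gh; subst h.
    congr pair; apply: val_inj; apply: gen_inj => //=.
    move: hj; rewrite gi => /ordS_inj/d_inj/mulgI/invg_inj ->.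
    by [].
  move=> /d_inj eq_h; have := step_back (gen_mem i2) gi.
  rewrite eq_h (step_back (gen_mem j2) hj) => /ordS_inj/d_inj gh; subst h.
  congr pair; apply: val_inj; apply: gen_inj => //=.
  by move/mulgI/invg_inj: eq_h.
- by case: ifP.
- by case: ifP.
- case=> /d_inj ->; congr pair; apply: val_inj => /=.
  have := ltn_ord i; have := ltn_ord j; lia.
Qed.

Lemma walk_colored_planar : planar_graph R (cay_adj (colored_gens a b 3)).
Proof.
apply: (planar_graph_emb walk_embedding_inj) (prism_planar m_gt2).
suff arc_adj (u v : gT * right_zero_band 3) : u <> v ->
    cay_arc (colored_gens a b 3) u v ->
    prism_adj (walk_embedding u) (walk_embedding v).
  move=> u v [uv [/(arc_adj _ _ uv)//|/(arc_adj _ _ (nesym uv))]].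
  by move=> [e [i E]]; exists e, i; case: E; auto.
case: u v => [g i] [h j] uv /colored_arc /= hE; subst h.
case: (walk_source g i) (walk_target g j) => [->|->|[-> i2]] [->|->|[-> j2]].
- by exists InnerRim, (d g); left.
- by exists Rung, (d g); left.
- by exists CentreInner, (d g); right.
- by exists Rung, (ordS (d g)); right.
- by exists OuterRim, (d g); right.
- by exists CentreNextOuter, (d g); right.
- by exists CentreNextInner, (d g); left.
- by exists CentreOuter, (d g); left.
- case: uv; have -> : i = j by apply: val_inj; rewrite /= i2 j2.
  by rewrite j2 mulg1.
Qed.

Lemma walk_two_planar : planar_graph R (cay_adj (two_gens a b 1)).
Proof.
pose f (v : gT * right_zero_band 1) : 'I_m * layer := (d v.1, Inner).
have f_inj : injective f.
  by move=> [g i] [h j] [/d_inj gh]; rewrite gh (ord1 i) (ord1 j).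
apply: (planar_graph_emb f_inj) (prism_planar m_gt2).
have step (u v : gT * right_zero_band 1) : cay_arc (two_gens a b 1) u v ->
    d v.1 = ordS (d u.1) \/ d u.1 = ordS (d v.1).
  by case/two_arc => ->; apply: d_step; rewrite !inE eqxx ?orbT.
have rim (i : 'I_m) : prism_adj (i, Inner) (ordS i, Inner).
  by exists InnerRim, i; left.
have rim' (i : 'I_m) : prism_adj (ordS i, Inner) (i, Inner).
  by exists InnerRim, i; right.
by move=> u v [_ [/step[]|/step[]]]; rewrite /f => ->.
Qed.

End CyclicWalk.

(** * Cyclic and dihedral groups *)

(** Generation makes the closed walk [s] surjective, and counting makes it bijective; its inverse is
    the numbering [d]. *)
Lemma cyclic_walk_planar (R : realType) (gT : finGroupType) (a b : gT) m
    (s : 'I_m -> gT) (i0 : 'I_m) k :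
    2 < m -> #|gT| = m -> a != b -> <<[set a; b]>> = [set: gT] -> s i0 = 1 ->
    (forall i c, c \in [:: a; b] ->
       s i * c = s (ordS i) \/ s i * c = s (ord_pred i)) ->
  0 < k <= 3 -> planar_semigroup R (gT * right_zero_band k)%type.
Proof.
move=> m_gt2 card_gT ab gen_ab s1 s_step k_le3.
have s_surj g : exists i, s i == g.
  have : g \in <<[set a; b]>> by rewrite gen_ab inE.
  apply: (gen_ind (P := fun g => exists i, s i == g)) => {g}.
    by exists i0; rewrite s1.
  move=> c g c_ab [i /eqP <-].
  have {}c_ab : c \in [:: a; b] by move: c_ab; rewrite !inE.
  by case: (s_step i c c_ab) => ->; eexists; apply: eqxx.
pose d g := xchoose (s_surj g).
have dK : cancel d s by move=> g; apply/eqP/(xchooseP (s_surj g)).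
have sK : cancel s d.
  have d_bij : bijective d.
    by apply: inj_card_bij; [exact: can_inj dK | rewrite card_ord card_gT].
  exact: (bij_can_sym d_bij s).2 dK.
have d_step g c : c \in [:: a; b] ->
    d (g * c) = ordS (d g) \/ d g = ordS (d (g * c)).
  move=> c_ab; rewrite -{1 4}(dK g).
  case: (s_step (d g) c c_ab) => ->; rewrite sK; first by left.
  by right; rewrite ord_predK.
apply: (planar_right_groups gen_ab _ _ k_le3).
  exact: walk_two_planar m_gt2 (can_inj dK) d_step.
exact: walk_colored_planar m_gt2 ab (can_inj dK) d_step.
Qed.

Lemma cyclic_planar (R : realType) (gT : finGroupType) k :
    cyclic [set: gT] -> 2 < #|gT| ->
  0 < k <= 3 -> planar_semigroup R (gT * right_zero_band k)%type.
Proof.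
case/cyclicP=> x gT_x m_gt2 k_le3.
have ox : #[x] = #|gT| by rewrite orderE -gT_x cardsT.
have xm : x ^+ #|gT| = 1 by rewrite -ox expg_order.
have xmod j : x ^+ (j %% #|gT|) = x ^+ j by rewrite expg_mod.
pose s (i : 'I_#|gT|) := x ^+ i.
pose i0 := Ordinal (ltn_trans (isT : 0 < 2) m_gt2).
apply: (@cyclic_walk_planar R gT x x^-1 _ s i0) => //.
- apply/eqP => xV; have : x ^+ 2 = 1 by rewrite expgS expg1 {2}xV mulgV.
  by move/eqP; rewrite -order_dvdn ox => /dvdn_leq; lia.
- by apply/eqP; rewrite -subTset gT_x genS // sub1set !inE eqxx.
- move=> i c; rewrite !inE => /orP[/eqP->|/eqP->]; rewrite /s /= !xmod.
    by left; rewrite expgSr.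
  (* [ord_pred i] is [(i + m).-1 %% m] with [m = #|gT|], and [x ^+ m] is trivial. *)
  right; apply: (mulIg x); rewrite mulgKV -expgSr.
  rewrite prednK ?ltn_addl ?(leq_ltn_trans _ (ltn_ord i)) //.
  by rewrite expgD xm mulg1.
Qed.

Lemma dihedral_planar (R : realType) (gT : finGroupType) n k :
    1 < n -> [set: gT] \isog [set: 'D_n.*2] ->
  0 < k <= 3 -> planar_semigroup R (gT * right_zero_band k)%type.
Proof.
move=> n_gt1 isoD k_le3.
have card_gT : #|gT| = n.*2.
  by rewrite -cardsT (card_isog isoD) (card_dihedral n_gt1).
(* The presentation by two reflections whose product is the rotation. *)
have : [set: gT] \homg Grp (x : y : x ^+ 2, y ^+ 2, (x * y) ^+ n).
  by rewrite -(Grp'_dihedral n_gt1) isog_hom.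
case/existsP=> -[x y] /= /eqP[gen_xy x2 y2 xyn].
have {}gen_xy : <<[set x; y]>> = [set: gT].
  by rewrite -gen_xy joing_idl joing_idr.
have xx : x * x = 1 by rewrite -x2 expgS expg1.
have yy : y * y = 1 by rewrite -y2 expgS expg1.
have m_gt2 : 2 < n.*2 by rewrite -muln2; lia.
pose letter (i : nat) := if odd i then y else x.
(* The alternating word x y x ... of length [i]; [letter i] is the letter that comes next. *)
pose S i := (x * y) ^+ i./2 * (if odd i then x else 1).
have letter2 i : letter i * letter i = 1 by rewrite /letter; case: odd.
have S_next i : S i.+1 = S i * letter i.
  rewrite /S /letter /= uphalf_half; case: (odd i) => /=.
    by rewrite add1n expgSr mulg1 !mulgA.
  by rewrite add0n mulg1.
pose s (i : 'I_n.*2) := S i.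
have s_next i : s (ordS i) = s i * letter i.
  rewrite -S_next /s /=; have := ltn_ord i.
  rewrite leq_eqVlt => /orP[/eqP->|lt_i].
    by rewrite modnn /S odd_double doubleK xyn.
  by rewrite modn_small.
pose i0 := Ordinal (ltn_trans (isT : 0 < 2) m_gt2).
apply: (@cyclic_walk_planar R gT x y _ s i0) => //.
- apply/eqP => xy; have : #|gT| <= 2.
    rewrite -cardsT -gen_xy -xy setUid -[#|_|]/#[x].
    by rewrite dvdn_leq // order_dvdn x2.
  by rewrite card_gT; lia.
- by rewrite /s /S /= mul1g.
- move=> i c c_xy.
  have [->|c_neq] := eqVneq c (letter i); first by left; rewrite s_next.
  (* The other generator is the previous letter, also across the wrap since the cycle has even
     length; being an involution, it undoes the last step. *)
  right; have -> : c = letter (ord_pred i).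
    move: c_neq c_xy; rewrite /letter !inE /=.
    have -> : odd ((i + n.*2).-1 %% n.*2) = ~~ odd i.
      have -> : odd ((i + n.*2).-1 %% n.*2) = odd (i + n.*2).-1.
        rewrite [in RHS](divn_eq (i + n.*2).-1 n.*2).
        by rewrite oddD oddM odd_double andbF.
      have : (0 < i + n.*2)%N by lia.
      move=> /prednK/(congr1 odd); rewrite /= oddD odd_double addbF => <-.
      by rewrite negbK.
    by case: (odd i) => /= c_neq /orP[]/eqP cE //; rewrite cE eqxx in c_neq.
  by rewrite -{1}(ord_predK i) s_next -mulgA letter2 mulg1.
Qed.

Theorem theorem4p4 (R : realType) :
  (forall (gT : finGroupType) (k : nat),
     [set: gT] = 1
     \/ (exists2 n, 0 < n & [set: gT] \isog Zp n)
     \/ (exists2 n, 1 < n & [set: gT] \isog [set: 'D_n.*2])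
     \/ [set: gT] \isog 'Sym_('I_4)
     \/ [set: gT] \isog 'Alt_('I_4)
     \/ [set: gT] \isog 'Alt_('I_5) ->
     0 < k <= 3 ->
     planar_semigroup R (gT * right_zero_band k)%type)
  /\
  (forall (gT : finGroupType) (k' : nat),
     [set: gT] = 1 -> 0 < k' <= 4 ->
     planar_semigroup R (gT * right_zero_band k')%type).
Proof.
split=> [gT k | gT k]; last exact: trivial_planar.
have trivial : [set: gT] = 1 -> 0 < k <= 3 ->
    planar_semigroup R (gT * right_zero_band k)%type.
  by move=> gT1 /andP[k_gt0 k_le3]; apply: trivial_planar => //; rewrite k_gt0 ltnW.
case=> [|[[n n_gt0 iso]|[[n n_gt1]|[|[|]]]]].
- exact: trivial.
- have card_gT : #|[set: gT]| = n by rewrite (card_isog iso) card_Zp.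
  (* The cycle needs at least three vertices, so order 1 goes to the trivial group and order 2 to
     the symmetric group on two points. *)
  have [n_le1|n_gt1] := leqP n 1.
    by apply: trivial; apply/card1_trivg/eqP; rewrite eqn_leq card_gT n_le1.
  have [n_gt2|n_le2] := ltnP 2 n.
    apply: cyclic_planar; last by rewrite -cardsT card_gT.
    by rewrite (isog_cyclic iso) /= /Zp n_gt1 Zp_cycle cycle_cyclic.
  move=> k_le3; apply: Sym2_planar => //.
  have n2 : n = 2 by lia.
  by rewrite isog_cyclic_card ?prime_cyclic ?card_gT ?n2 //= ?card_Sym ?card_ord.
- exact: dihedral_planar.
- by move=> iso k_le3; apply: Sym4_planar.
- by move=> iso k_le3; apply: Alt4_planar.
- by move=> iso k_le3; apply: Alt5_planar.
Qed.
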